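(* Let $q\geq 2$, $k\geq 2$ and $d\geq k$ be three integers, $I$ be an instance of $\mathsf{k\,CSP\!-\!q}$ with $n\geq k$ variables, and $x\in\Sigma_q^n$ be a solution of $I$. Then the ratio of the maximum difference between two solution values over $B^d(x)$ to the diameter of $I$, and the ratio of the maximum difference between two solution values over $\tilde{B}^d(x)$ to the diameter of $I$, are respectively at least $$\frac{k!}{(2n-k)^k}\quad\text{and}\quad\frac{k!}{\left(2(q-1)n/q-k\right)^k}.$$
   Context: Let $\Sigma_q=\{0,1,\ldots,q-1\}$, with arithmetic modulo $q$ (componentwise on vectors), and $[n]=\{1,\ldots,n\}$; for $a\in\Sigma_q$, $\mathbf{a}=(a,\ldots,a)$. An instance $I$ of $\mathsf{k\,CSP\!-\!q}$ with $n$ variables consists of an integer $m\ge 1$, a goal (maximize or minimize) and, for each $i\in[m]$, a weight $w_i>0$, an integer $1\le k_i\leq \min\{k,n\}$, a strictly increasing sequence $J_i=(i_1,\ldots,i_{k_i})$ of indices of $[n]$, and a function $P_i:\Sigma_q^{k_i}\to\mathbb{R}$. Solutions are vectors $x\in\Sigma_q^n$, with value $v(I,x)=\sum_{i=1}^m w_iP_i(x_{i_1},\ldots,x_{i_{k_i}})$. $\mathrm{opt}(I)$ and $\mathrm{wor}(I)$ are the best and worst solution values (maximum and minimum of $v(I,\cdot)$ if maximizing, minimum and maximum if minimizing). The diameter of $I$ is $|\mathrm{opt}(I)-\mathrm{wor}(I)|$ (ratios to it are considered when it is nonzero). The maximum difference between two solution values over a set $B\subseteq\Sigma_q^n$ is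 $\max_{y\in B}v(I,y)-\min_{y\in B}v(I,y)$. $B^d(x)$ is the set of $y\in\Sigma_q^n$ at Hamming distance at most $d$ from $x$ (the Hamming distance being the number of coordinates on which two vectors differ), and $\tilde{B}^d(x)=\bigcup_{a=0}^{q-1}B^d(x+\mathbf{a})$.
   Formalization: The second bound is replaced by 1 when it exceeds 1 or its denominator is 0: a ratio to the diameter is at most 1, so the printed bound fails for some small n (q=k=d=2, n=3 gives 2) and is undefined for q=2, n=k. *)

(* Defs.v *)
(* MathComp, with the real numbers taken to be an arbitrary realType. *)
From mathcomp Require Import all_boot all_order all_algebra.
From mathcomp Require Import reals.

Set Implicit Arguments.
Unset Strict Implicit.
Unset Printing Implicit Defensive.

Import Order.TTheory GRing.Theory Num.Theory.
Local Open Scope ring_scope.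

(* Sigma_q is 'Z_q, which is the integers mod q only for q >= 2; statements
   must assume this. Addition on finite functions is componentwise. *)
Notation vec q n := {ffun 'I_n -> 'Z_q}.

Variant goal := Maximize | Minimize.

Record constraint (R : realType) (q k n : nat) := Constraint {
  weight : R;
  weight_gt0 : 0 < weight;
  arity : nat;
  arity_gt0 : (1 <= arity)%N;
  arity_le : (arity <= minn k n)%N;
  scope : 'I_arity -> 'I_n;
  scope_incr : forall i j : 'I_arity, (i < j)%N -> (scope i < scope j)%N;
  payoff : vec q arity -> R
}.
Arguments payoff {R q k n} c _.
Arguments scope {R q k n} c _.

Record instance (R : realType) (q k n : nat) := Instance {
  ncons : nat;
  ncons_gt0 : (1 <= ncons)%N;
  igoal : goal;
  cons_of : 'I_ncons -> constraint R q k n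
}.
Arguments cons_of {R q k n} i _.

Section Values.

Variables (R : realType) (q k n : nat).
Implicit Types (I : instance R q k n) (x y : vec q n) (B : {set vec q n}).

Definition cvalue (c : constraint R q k n) x : R :=
  payoff c [ffun j : 'I_(arity c) => x (scope c j)].

Definition value I x : R :=
  \sum_(i < ncons I) weight (cons_of I i) * cvalue (cons_of I i) x.

(* Extreme values over B. The point x0 only witnesses that B is nonempty:
   the result is meaningful, and independent of x0, when x0 \in B. *)
Definition max_value I x0 B : R :=
  value I [arg max_(y > x0 in B) value I y]%O.
Definition min_value I x0 B : R :=
  value I [arg min_(y < x0 in B) value I y]%O.

Definition max_diff I x0 B : R := max_value I x0 B - min_value I x0 B.

Definition opt I : R :=
  match igoal I with
  | Maximize => max_value I 0 [set: vec q n]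
  | Minimize => min_value I 0 [set: vec q n]
  end.

Definition wor I : R :=
  match igoal I with
  | Maximize => min_value I 0 [set: vec q n]
  | Minimize => max_value I 0 [set: vec q n]
  end.

Definition diameter I : R := `|opt I - wor I|.

Definition hdist x y : nat := #|[set i | x i != y i]|.

Definition hball (d : nat) x : {set vec q n} := [set y | (hdist x y <= d)%N].

(* Union of the balls around the translates of x by constant vectors. *)
Definition shift_ball (d : nat) x : {set vec q n} :=
  \bigcup_(a : 'Z_q) hball d (x + [ffun=> a]).

End Values.

(* Main.v *)
Require Import Defs.
From mathcomp Require Import all_boot all_order all_algebra.
From mathcomp Require Import reals.
From mathcomp Require Import ring lra zify.
Import Order.TTheory GRing.Theory Num.Theory.
Local Open Scope ring_scope.

(** The inequality below is an extrapolation bound.  Let [y] and [z] be two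
    solutions, and let [f J] be the value of the solution that takes the
    coordinates in [J] from [z] and the others from [y].  Every constraint reads
    at most [k] coordinates, so [f] is a function of degree at most [k] on the
    Boolean cube.  Such a function is determined by its values on sets of size
    at most [k], and the values there are values of solutions at distance at
    most [k] from [y]: if they all lie within [r] of some [c], then [v z] cannot
    be far from [c].

    Quantitatively ([deg_le_growth]), with [h] the number of coordinates on
    which [y] and [z] differ and [h >= k],
      |v z - c| * k! <= (2 h - k)^k * r.
    Extrapolation coefficients are never computed.  Removing one coordinate [e]
    splits [f D] as [f (D - e)] plus the derivative of [f] along [e] taken at
    [D - e]; the derivative has degree at most [k - 1] and lies within [2 r] of
    [0] on small sets, so induction applies to both terms.  The two bounds add
    up because (a - 1)^k + 2 k a^(k-1) <= (a + 1)^k ([leq_expn_central_diff]).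

    Taking [c] and [r] to be the midpoint and the half-width of the range of
    values on a set containing the ball around [y], and [z] an optimal and then
    a worst solution, bounds the diameter by [(2 h - k)^k / k!] times that range
    ([max_diff_ratio]).  For a ball, [h <= n].  For the shifted balls, the
    average over the [q] constant shifts [a] of the distance from [x + a] to [z]
    is [(q - 1) n / q], so some centre has [h <= (q - 1) n / q]
    ([exists_close_shift]). *)

(** * Powers and factorials *)

(** Convexity of the power function, comparing its slope on the interval from
    [a] to [a + 1] with its derivative at the right endpoint. *)
Lemma leq_expn_slope (a k : nat) :
  (a.+1 ^ k.+1 <= a ^ k.+1 + k.+1 * a.+1 ^ k)%N.
Proof.
elim: k => [|k IHk]; first by rewrite !expn1 expn0; lia.
rewrite expnS (expnS a k.+1) (expnS a.+1 k).
have := leq_mul (leqnn a) IHk.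
rewrite (expnS a.+1 k) in IHk *.
nia.
Qed.

(** In the expansion of [(b + 1)^(k+1) - (b - 1)^(k+1)] at [b = a + 1] only
    the terms of odd order survive, and the first is [2 (k+1) b^k]. *)
Lemma leq_expn_central_diff (a k : nat) :
  (a ^ k.+1 + 2 * k.+1 * a.+1 ^ k <= a.+2 ^ k.+1)%N.
Proof.
elim: k => [|k IHk]; first by rewrite !expn1 expn0; lia.
have slope := leq_expn_slope a k.
rewrite (expnS a.+2) (expnS a k.+1).
have := leq_mul (leqnn a.+2) IHk.
rewrite (expnS a.+1 k) in slope *.
nia.
Qed.

Lemma fact_leq_expn (k : nat) : (k`! <= k ^ k)%N.
Proof.
elim: k => // k IHk; rewrite factS expnS leq_pmul2l //.
by apply: leq_trans IHk _; case: k => // k; rewrite leq_exp2r.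
Qed.

Lemma fact_leq_expn_range (h k : nat) :
  (k <= h)%N -> (k`! <= (2 * h - k) ^ k)%N.
Proof.
move=> le_kh; apply: leq_trans (fact_leq_expn k) _.
by case: k le_kh => // k le_kh; rewrite leq_exp2r //; lia.
Qed.

(** * Functions of bounded degree on the Boolean cube *)

Section Cube.

Variables (R : realType) (T : finType).
Implicit Types (f g : {set T} -> R) (e : T) (J D S : {set T}).

Definition cube_deriv f e J : R := f (e |: J) - f (J :\ e).

(** Degree at most [k] as a real multilinear polynomial in the indicators of
    membership, expressed by the vanishing of iterated derivatives so that
    differentiation lowers the degree by definition. *)
Fixpoint deg_le (k : nat) f : Prop :=
  if k is k'.+1 then forall e, deg_le k' (cube_deriv f e)
  else forall J D, f J = f D.

Lemma eq_deg_le k f g : f =1 g -> deg_le k f -> deg_le k g.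
Proof.
elim: k f g => [|k IHk] f g eq_fg /= deg_f; first by move=> J D; rewrite -!eq_fg.
by move=> e; apply: IHk (deg_f e) => J; rewrite /cube_deriv !eq_fg.
Qed.

Lemma deg_leZ k (w : R) f : deg_le k f -> deg_le k (fun J => w * f J).
Proof.
elim: k f => [|k IHk] f /= deg_f; first by move=> J D; rewrite (deg_f J D).
move=> e; apply: eq_deg_le (IHk _ (deg_f e)) => J.
by rewrite /cube_deriv mulrBr.
Qed.

Lemma deg_le_sum k (I : Type) (s : seq I) (F : I -> {set T} -> R) :
  (forall i, deg_le k (F i)) -> deg_le k (fun J => \sum_(i <- s) F i J).
Proof.
elim: k F => [|k IHk] F /= deg_F.
  by move=> J D; apply: eq_bigr => i _; exact: deg_F.
move=> e; apply: (@eq_deg_le _ (fun J => \sum_(i <- s) cube_deriv (F i) e J)).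
  by move=> J; rewrite /cube_deriv sumrB.
by apply: (IHk (fun i => cube_deriv (F i) e)) => i; exact: deg_F.
Qed.

(** Differentiating along a point of [S] removes that point from [S];
    differentiating along any other point gives zero. *)
Lemma deg_le_junta k S f :
  (#|S| <= k)%N -> (forall J, f J = f (J :&: S)) -> deg_le k f.
Proof.
elim: k S f => [|k IHk] S f leSk f_S /=.
  move: leSk; rewrite leqn0 cards_eq0 => /eqP S0 J D.
  by rewrite f_S [RHS]f_S S0 !setI0.
move=> e; have [eS | eS] := boolP (e \in S).
  apply: (IHk (S :\ e)) => [|J].
    by move: leSk; rewrite (cardsD1 e S) eS.
  by rewrite /cube_deriv; congr (_ - _); rewrite f_S [RHS]f_S;
    congr f; apply/setP=> i; rewrite !inE; case: eqP => [->|_];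
    rewrite ?eS //=; do 2?case: (_ \in _).
apply: (IHk set0) => [|J]; first by rewrite cards0.
have deriv0 K : cube_deriv f e K = 0.
  apply/eqP; rewrite subr_eq0 f_S (f_S (K :\ e)); apply/eqP; congr f.
  apply/setP=> i; rewrite !inE.
  by case: eqP => [->|] //=; rewrite (negPf eS).
by rewrite !deriv0.
Qed.

(** Peel off a point [e]: [f D = f (D :\ e) + cube_deriv f e (D :\ e)]. *)
Lemma deg_le_growth k f (c r : R) D :
  deg_le k f -> (k <= #|D|)%N ->
  (forall J, J \subset D -> (#|J| <= k)%N -> `|f J - c| <= r) ->
  `|f D - c| * k`!%:R <= ((2 * #|D| - k) ^ k)%:R * r.
Proof.
move cardD: #|D| => m.
elim: m k f c r D cardD => [|m IHm] [|k] f c r D cardD deg_f lekm near_f //.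
- by rewrite fact0 expn0 mulr1 mul1r near_f // cardD.
- rewrite fact0 expn0 mulr1 mul1r (deg_f D set0).
  by rewrite near_f ?sub0set ?cards0.
have r_ge0 : 0 <= r.
  by apply: le_trans (near_f set0 (sub0set _) _); rewrite ?normr_ge0 ?cards0.
have [lt_km | ge_km] := ltnP k m; last first.
  have le_card : (#|D| <= k.+1)%N by rewrite cardD; lia.
  rewrite mulrC; apply: ler_pM => //; last exact: near_f.
  by rewrite ler_nat; exact: fact_leq_expn_range.
have [e eD] : exists e, e \in D by apply/card_gt0P; rewrite cardD.
pose D' := D :\ e.
have cardD' : #|D'| = m by move: cardD; rewrite (cardsD1 e D) eD => -[].
have sD'D : D' \subset D by exact: subsetDl.
have notin_e J : J \subset D' -> e \notin J.
  by move=> sJ; apply/negP => /(subsetP sJ); rewrite !inE eqxx.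
have derivE J : J \subset D' -> cube_deriv f e J = f (e |: J) - f J.
  move=> /notin_e eJ; congr (_ - f _).
  by apply/setP=> i; rewrite !inE; case: eqP => [->|//]; rewrite (negPf eJ).
have bound_low : `|f D' - c| * k.+1`!%:R <= ((2 * m - k.+1) ^ k.+1)%:R * r.
  apply: IHm => // J sJ leJ.
  by apply: near_f => //; exact: subset_trans sJ sD'D.
have bound_deriv :
  `|cube_deriv f e D' - 0| * k`!%:R <= ((2 * m - k) ^ k)%:R * (2 * r).
  apply: IHm => [//|||J sJ leJ]; [exact: deg_f | exact: ltnW |].
  rewrite subr0 derivE //.
  have near_eJ : `|f (e |: J) - c| <= r.
    apply: near_f; last by rewrite cardsU1 notin_e.
    by rewrite subUset sub1set eD (subset_trans sJ sD'D).
  have near_J : `|f J - c| <= r.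
    by apply: near_f; [exact: subset_trans sJ sD'D | exact: leqW].
  have := ler_normB (f (e |: J) - c) (f J - c).
  rewrite opprB addrA subrK => /le_trans; apply.
  by rewrite mulrDl !mul1r lerD.
have split_fD : f D - c = (f D' - c) + (cube_deriv f e D' - 0).
  by rewrite subr0 derivE // setD1K // [RHS]addrC subrKA.
have triangle := ler_normD (f D' - c) (cube_deriv f e D' - 0).
rewrite -split_fD in triangle.
have growth : ((2 * m - k.+1) ^ k.+1 + 2 * k.+1 * (2 * m - k) ^ k
               <= (2 * m.+1 - k.+1) ^ k.+1)%N.
  have -> : (2 * m - k = (2 * m - k.+1).+1)%N by lia.
  have -> : (2 * m.+1 - k.+1 = (2 * m - k.+1).+2)%N by lia.
  exact: leq_expn_central_diff.
apply: (@le_trans _ _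
  (((2 * m - k.+1) ^ k.+1 + 2 * k.+1 * (2 * m - k) ^ k)%:R * r)); last first.
  by apply: ler_wpM2r => //; rewrite ler_nat.
apply: le_trans (ler_wpM2r (ler0n _ _) triangle) _.
rewrite mulrDl natrD (mulrDl _ _ r); apply: lerD => //.
rewrite factS natrM mulrCA.
apply: le_trans (ler_wpM2l (ler0n _ _) bound_deriv) _.
by rewrite le_eqVlt; apply/orP; left; apply/eqP; rewrite !natrM; ring.
Qed.

End Cube.

(** * Values along the cube between two solutions *)

Section Extrapolation.

Variables (R : realType) (q k n : nat).
Implicit Types (I : instance R q k n) (x y z : vec q n) (B : {set vec q n}).

Definition mix y z (J : {set 'I_n}) : vec q n :=
  [ffun i => if i \in J then z i else y i].

Lemma deg_le_cvalue (c : constraint R q k n) y z :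
  deg_le R 'I_n k (fun J => cvalue c (mix y z J)).
Proof.
apply: (@deg_le_junta _ _ _ [set scope c j | j : 'I_(arity c)]).
  apply: leq_trans (leq_imset_card _ _) _; rewrite card_ord.
  by apply: leq_trans (arity_le c) _; rewrite geq_minl.
move=> J; congr payoff; apply/ffunP=> j; rewrite !ffunE inE.
by rewrite imset_f // andbT.
Qed.

Lemma deg_le_value I y z : deg_le R 'I_n k (fun J => value I (mix y z J)).
Proof. by apply: deg_le_sum => i; apply: deg_leZ; exact: deg_le_cvalue. Qed.

Lemma hdist_mix y z J : (hdist y (mix y z J) <= #|J|)%N.
Proof.
apply: subset_leq_card; apply/subsetP=> i; rewrite inE ffunE.
by case: ifP => //; rewrite eqxx.
Qed.

Lemma mix_diff y z : mix y z [set i | y i != z i] = z.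
Proof.
by apply/ffunP=> i; rewrite ffunE inE; case: eqP => //= ->.
Qed.

Lemma value_extrapolation I y z (c r M : R) :
  (forall w, w \in hball k y -> `|value I w - c| <= r) ->
  k`!%:R <= M ->
  ((k <= hdist y z)%N -> ((2 * hdist y z - k) ^ k)%:R <= M) ->
  `|value I z - c| * k`!%:R <= M * r.
Proof.
move=> near_ball le_fM le_hM.
have r_ge0 : 0 <= r.
  apply: le_trans (near_ball y _); first exact: normr_ge0.
  by rewrite inE /hdist (eq_card0 (_ : _ =i pred0)) // => i; rewrite !inE eqxx.
have [le_kh | /ltnW le_hk] := leqP k (hdist y z).
  apply: le_trans (ler_wpM2r r_ge0 (le_hM le_kh)).
  rewrite -{1}(mix_diff y z).
  apply: (deg_le_growth _ _ _ _ _ _ _ (deg_le_value I y z)) => // J _ leJ.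
  by apply: near_ball; rewrite inE; exact: leq_trans (hdist_mix _ _ _) leJ.
by rewrite mulrC; apply: ler_pM => //; apply: near_ball; rewrite inE.
Qed.

Lemma le_max_value I x B w : x \in B -> w \in B -> value I w <= max_value I x B.
Proof.
by move=> xB wB; rewrite /max_value; case: arg_maxP => // m _; apply.
Qed.

Lemma ge_min_value I x B w : x \in B -> w \in B -> min_value I x B <= value I w.
Proof.
by move=> xB wB; rewrite /min_value; case: arg_minP => // m _; apply.
Qed.

Lemma diameter_attained I :
  exists z1 z2, diameter I = `|value I z1 - value I z2|.
Proof.
rewrite /diameter /opt /wor /max_value /min_value.
by case: (igoal I); do 2!eexists; reflexivity.
Qed.

(** The centre [y] may depend on the solution [z] to be reached, which the
    union of shifted balls exploits. *)
Lemma max_diff_ratio I x B (M : R) :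
  x \in B -> diameter I != 0 -> k`!%:R <= M ->
  (forall z, exists2 y, hball k y \subset B
     & (k <= hdist y z)%N -> ((2 * hdist y z - k) ^ k)%:R <= M) ->
  k`!%:R / M <= max_diff I x B / diameter I.
Proof.
move=> xB diam_neq0 le_fM reach.
have fact_gt0R : 0 < k`!%:R :> R by rewrite ltr0n fact_gt0.
have M_gt0 : 0 < M by exact: lt_le_trans fact_gt0R le_fM.
have diam_gt0 : 0 < diameter I by rewrite lt0r diam_neq0 normr_ge0.
pose c := (max_value I x B + min_value I x B) / 2.
pose r := max_diff I x B / 2.
have near_B w : w \in B -> `|value I w - c| <= r.
  move=> wB; rewrite ler_norml /c /r /max_diff.
  have := le_max_value I _ _ _ xB wB; have := ge_min_value I _ _ _ xB wB.
  by move=> ? ?; apply/andP; split; lra.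
have near_all z : `|value I z - c| * k`!%:R <= M * r.
  have [y /subsetP sB le_hM] := reach z.
  by apply: value_extrapolation le_fM le_hM => w /sB; exact: near_B.
have [z1 [z2 diamE]] := diameter_attained I.
rewrite ler_pdivlMr // mulrAC ler_pdivrMr // mulrC [leRHS]mulrC.
have -> : M * max_diff I x B = M * r + M * r by rewrite /r -mulrDr -splitr.
apply: le_trans (lerD (near_all z1) (near_all z2)).
rewrite -mulrDl ler_wpM2r ?ler0n // diamE.
have := ler_normB (value I z1 - c) (value I z2 - c).
by rewrite opprB addrA subrK.
Qed.

End Extrapolation.

(** * Distances between solutions *)

Section Distances.

Variables (q n : nat).
Implicit Types (x y z : vec q n).

Lemma hdist_le y z : (hdist y z <= n)%N.
Proof. by rewrite -[leqRHS]card_ord max_card. Qed.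

Lemma hdistxx x : hdist x x = 0%N.
Proof. by apply: eq_card0 => i; rewrite !inE eqxx. Qed.

Lemma hball_mono (k d : nat) x :
  (k <= d)%N -> hball k x \subset hball d x.
Proof.
by move=> le_kd; apply/subsetP=> y; rewrite !inE => /leq_trans; apply.
Qed.

(** On each coordinate exactly one of the [q] shifts agrees with [z], so the
    distances from the shifts of [x] to [z] add up to [(q - 1) * n]. *)
Lemma exists_close_shift x z : (2 <= q)%N ->
  exists a : 'Z_q, (q * hdist (x + [ffun=> a])%R z <= (q - 1) * n)%N.
Proof.
move=> q_ge2; have card_q : #|'Z_q| = q by rewrite card_ord Zp_cast.
have hdistE a : hdist (x + [ffun=> a])%R z = (\sum_i (x i + a != z i)%R)%N.
  rewrite /hdist -sum1_card big_mkcond /=; apply: eq_bigr => i _.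
  by rewrite inE !ffunE; case: (_ != _).
have sum_hdist : (\sum_(a : 'Z_q) hdist (x + [ffun=> a])%R z = (q - 1) * n)%N.
  under eq_bigr => a _ do rewrite hdistE.
  rewrite exchange_big /= -[in RHS](card_ord n) mulnC -sum_nat_const.
  apply: eq_bigr => i _.
  rewrite (bigD1 (z i - x i)) //= addrC subrK eqxx add0n.
  rewrite (eq_bigr (fun=> 1%N)); last first.
    by move=> a; rewrite eq_sym subr_eq eq_sym addrC => ->.
  by rewrite sum1_card cardC1 card_q subn1.
have [/existsP //|] := boolP [exists a : 'Z_q,
  (q * hdist (x + [ffun=> a])%R z <= (q - 1) * n)%N].
rewrite negb_exists => /forallP far.
have : (\sum_(a : 'Z_q) ((q - 1) * n).+1
        <= \sum_(a : 'Z_q) q * hdist (x + [ffun=> a])%R z)%N.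
  by apply: leq_sum => a _; rewrite ltnNge far.
rewrite -big_distrr /= sum_hdist sum_nat_const card_q leq_pmul2l ?ltnn //.
exact: ltnW.
Qed.

End Distances.

(* The second bound k! / D^k is capped at 1: it exceeds 1 (or is k!/0) for some
   small n, e.g. q = 2, k = 2, n = 3, whereas the ratio is at most 1. *)
Theorem corollary4p2 (R : realType) (q k d n : nat)
    (q_ge2 : (2 <= q)%N) (k_ge2 : (2 <= k)%N) (d_gek : (k <= d)%N)
    (n_gek : (k <= n)%N)
    (I : instance R q k n) (x : {ffun 'I_n -> 'Z_q})
    (diam_neq0 : diameter I != 0) :
  k`!%:R / (2 * n%:R - k%:R) ^+ k <= max_diff I x (hball d x) / diameter I
  /\
  (let D : R := 2 * (q%:R - 1) * n%:R / q%:R - k%:R in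
   (if k`!%:R <= D ^+ k then k`!%:R / D ^+ k else 1)
     <= max_diff I x (shift_ball d x) / diameter I).
Proof.
have k_gt0 : (0 < k)%N by exact: ltnW.
have range_natr h : (k <= h)%N -> (2 * h - k)%:R = 2 * h%:R - k%:R :> R.
  by move=> le_kh; rewrite natrB ?natrM //; lia.
split.
  rewrite -range_natr // -natrX; apply: max_diff_ratio => //.
  - by rewrite inE hdistxx.
  - by rewrite ler_nat; exact: fact_leq_expn_range.
  move=> z; exists x; first exact: hball_mono.
  move=> le_kh; rewrite ler_nat leq_exp2r //.
  by apply: leq_sub2r; rewrite leq_mul2l hdist_le.
move=> D.
have range_le_D h : (q * h <= (q - 1) * n)%N -> 2 * h%:R - k%:R <= D.
  move=> close; rewrite /D lerD2r -!mulrA ler_pM2l // mulrA.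
  rewrite ler_pdivlMr ?ltr0n; last exact: ltnW.
  rewrite -(ler_nat R) !natrM natrB in close; last exact: ltnW.
  by rewrite mulrC.
have x_in : x \in shift_ball d x.
  apply/bigcupP; exists 0 => //; rewrite inE.
  by rewrite (_ : x + _ = x) ?hdistxx //; apply/ffunP=> i; rewrite !ffunE addr0.
have shift_sub a : hball k (x + [ffun=> a]) \subset shift_ball d x.
  apply: subset_trans (hball_mono _ _ _ _ _ d_gek) _.
  exact: (bigcup_sup a).
have range_exp_le h : (k <= h)%N -> (q * h <= (q - 1) * n)%N ->
    ((2 * h - k) ^ k)%:R <= D ^+ k.
  move=> le_kh close; rewrite natrX; apply: lerXn2r.
  - by rewrite nnegrE ler0n.
  - by rewrite nnegrE; apply: le_trans (range_le_D _ close);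
      rewrite -range_natr.
  - by rewrite range_natr // range_le_D.
case: ifPn => [le_fD | nle_fD].
  apply: max_diff_ratio => // z.
  have [a close] := exists_close_shift _ _ x z q_ge2.
  by exists (x + [ffun=> a]) => // le_kh; exact: range_exp_le.
(* Here every solution is within distance [k] of some shift of [x]: otherwise
   [k! <= (2 h - k)^k <= D^k]. *)
rewrite -(@divff _ (k`!%:R : R)) ?pnatr_eq0 -?lt0n ?fact_gt0 //.
apply: max_diff_ratio => // z.
have [a close] := exists_close_shift _ _ x z q_ge2.
exists (x + [ffun=> a]) => // le_kh.
case/negP: nle_fD; apply: le_trans (range_exp_le _ le_kh close).
by rewrite ler_nat; exact: fact_leq_expn_range.
Qed.
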